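(* Let $\beta=2$ and $u_i^0>0$ for $i\in\mathbb{T}_h^d$. Then there exists a positive solution $(u_i)_{i\in\mathbb{T}_h^d}$, with $u_i(0)=u_i^0$, to the finite-difference scheme $$\partial_t u_i=-\operatorname{div}_h^+J_i,\qquad J_i=\nabla_h^-A_i-v_i\nabla_h^-B_i,$$ $$A_i=\frac{\bar u_i^\beta}{v_i}\big(\lambda_1\xi_{2,i}+\lambda_2\xi_{1,i}^2\big),\qquad B_i=\frac{\bar u_i^\beta}{v_i^2}\big(\lambda_3\xi_{2,i}+\lambda_4\xi_{1,i}^2\big),$$ where $v_i=-u_i^{-1}$, $\xi_{2,i}=\Delta_hv_i/v_i$, $\xi_{1,i}^2=|\nabla_h^+v_i/v_i|^2$, and $$\lambda_1=\beta+1,\quad\lambda_2=-2(\beta+1),\quad\lambda_3=\beta,\quad\lambda_4=-2\beta .$$ Moreover, with $S_0^h=h\sum_{i\in\mathbb{T}_h^d}(-\log u_i)$, it holds that $dS_0^h/dt\le 0$ for all $t>0$.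
   Context: The scheme discretizes the thin-film equation $\partial_t u=-\operatorname{div}(u^\beta\nabla\Delta u)$ on the $d$-dimensional torus. $\mathbb{T}_h^d$ is the discrete $d$-dimensional torus with grid size $h=1/N$ ($N$ a positive integer), i.e. the finite periodic grid $(h\mathbb{Z}/\mathbb{Z})^d$; $e_\mu$ is the $\mu$-th unit vector of $\mathbb{R}^d$, and $u_i=u(i)$ for $u:\mathbb{T}_h^d\to\mathbb{R}$. Finite differences: $\partial_\mu^+u_i=\frac1h(u(i+he_\mu)-u(i))$, $\partial_\mu^-u_i=\frac1h(u(i)-u(i-he_\mu))$, $\mu=1,\dots,d$. Discrete divergence of $F=(F_1,\dots,F_d):\mathbb{T}_h^d\to\mathbb{R}^d$: $\operatorname{div}_h^+F=\sum_{\mu=1}^d\partial_\mu^+F_\mu$; discrete gradients: $(\nabla_h^\pm u)_\mu=\partial_\mu^\pm u$; discrete Laplacian: $\Delta_hu=\operatorname{div}_h^+\nabla_h^-u$. $\bar u_i$ is an arbitrary average of $u$ around the grid point $i$. The scheme is a system of ODEs in $t$. *)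

(* Defs.v *)
From HB Require Import structures.
From mathcomp Require Import all_boot all_order all_algebra.
From mathcomp Require Import all_classical all_reals all_analysis.
Set Implicit Arguments.
Unset Strict Implicit.
Unset Printing Implicit Defensive.
Import Order.TTheory GRing.Theory Num.Theory.
Import numFieldNormedType.Exports.
Local Open Scope ring_scope.

(* The grid (hZ/Z)^d with h = 1/N: the multi-index k stands for the point
   h k, each coordinate being read modulo N.  'I_N with the cyclic maps ordS
   and ord_pred is used rather than 'Z_N because the latter is Z/2 at N = 1. *)
Definition torus (d N : nat) := {ffun 'I_d -> 'I_N}.

Section Scheme.
Context {R : realType} {d N : nat}.
Implicit Types (u v : torus d N -> R) (F : torus d N -> 'rV[R]_d).
Implicit Types (i : torus d N) (mu : 'I_d).

Definition mesh_size : R := N%:R^-1.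

(* The points i + h e_mu and i - h e_mu. *)
Definition shift_plus mu i : torus d N :=
  [ffun nu => if nu == mu then ordS (i nu) else i nu].
Definition shift_minus mu i : torus d N :=
  [ffun nu => if nu == mu then ord_pred (i nu) else i nu].

Definition diff_plus mu u i : R :=
  mesh_size^-1 * (u (shift_plus mu i) - u i).
Definition diff_minus mu u i : R :=
  mesh_size^-1 * (u i - u (shift_minus mu i)).

Definition divh_plus F i : R :=
  \sum_(mu < d) diff_plus mu (fun j => F j 0 mu) i.
Definition gradh_plus u i : 'rV[R]_d := \row_mu diff_plus mu u i.
Definition gradh_minus u i : 'rV[R]_d := \row_mu diff_minus mu u i.
Definition laph u i : R := divh_plus (gradh_minus u) i.

(* Squared Euclidean norm; the library norm on 'rV is the sup norm. *)
Definition sqnorm (x : 'rV[R]_d) : R := \sum_(mu < d) x 0 mu ^+ 2.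

Definition positive_grid u : Prop := forall i, 0 < u i.

(* avg i u is the average of u around i and V i the set of grid points over
   which it is taken.  An average depends only on the values of u on V i, lies
   between the least and the largest of them (so V i is nonempty), and is
   continuous in u for the product topology.  Only positive u matter, so that
   geometric, harmonic, logarithmic, ... means are included. *)
Record is_average (V : torus d N -> {set torus d N})
    (avg : torus d N -> (torus d N -> R) -> R) : Prop := IsAverage {
  average_local : forall i u w, positive_grid u -> positive_grid w ->
    (forall j, j \in V i -> u j = w j) -> avg i u = avg i w ;
  average_between : forall i u (a b : R), positive_grid u ->
    (forall j, j \in V i -> a <= u j <= b) -> a <= avg i u <= b ;
  average_continuous : forall i u, positive_grid u ->
    {for u, continuous (avg i : {ptws torus d N -> R} -> R)} }.

Definition lambda1 (beta : R) : R := beta + 1.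
Definition lambda2 (beta : R) : R := - (2 * (beta + 1)).
Definition lambda3 (beta : R) : R := beta.
Definition lambda4 (beta : R) : R := - (2 * beta).

Definition xi2 v i : R := laph v i / v i.
Definition xi1sq v i : R := sqnorm ((v i)^-1 *: gradh_plus v i).

Definition vvar u i : R := - (u i)^-1.

Definition Afun (beta : R) (avg : torus d N -> (torus d N -> R) -> R) u i : R :=
  let v := vvar u in
  (avg i u) `^ beta / v i *
  (lambda1 beta * xi2 v i + lambda2 beta * xi1sq v i).

Definition Bfun (beta : R) (avg : torus d N -> (torus d N -> R) -> R) u i : R :=
  let v := vvar u in
  (avg i u) `^ beta / v i ^+ 2 *
  (lambda3 beta * xi2 v i + lambda4 beta * xi1sq v i).

Definition flux (beta : R) (avg : torus d N -> (torus d N -> R) -> R) u i :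
    'rV[R]_d :=
  gradh_minus (Afun beta avg u) i - vvar u i *: gradh_minus (Bfun beta avg u) i.

(* The prefactor is h, not h ^ d, in every dimension. *)
Definition entropy0 u : R := mesh_size * \sum_(i : torus d N) (- ln (u i)).

End Scheme.

(* Main.v *)
(* With v = -1/u, summation by parts gives
     sum_i v_i div J_i = sum_i avg_i^2 (xi_2 - 2 xi_1^2)_i^2 >= 0
   when beta = 2, while sum_i div J_i = 0.  So along the flow the mass is
   conserved and the entropy sum_i -ln u_i does not increase; together they keep
   every u_i in a compact interval [a, b] of (0, oo).  As the averages are only
   continuous, local existence has to be Peano's, and it is applied to the
   vector field precomposed with the clamping onto [a, b], which is bounded and
   continuous, so that solutions are global.  For the clamped field the entropy
   is replaced by its C^1 extension with derivative -1 / clamp; it still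
   decreases, hence the solution never leaves [a, b] and solves the scheme.
   Peano's theorem is obtained by taking pointwise limits of Euler schemes
   along an ultrafilter, so that neither Arzela-Ascoli nor an integral equation
   is needed. *)

Require Import Defs.
From HB Require Import structures.
From mathcomp Require Import all_boot all_order all_algebra.
From mathcomp Require Import all_classical all_reals all_analysis.
From mathcomp Require Import ring lra.
Set Implicit Arguments.
Unset Strict Implicit.
Import Order.TTheory GRing.Theory Num.Theory.
Import numFieldNormedType.Exports.
Local Open Scope classical_set_scope.
Local Open Scope ring_scope.

(** * Ultrafilter limits, differentiability and the pointwise topology *)

Lemma fmap_ultra (T U : Type) (f : T -> U) (F : set_system T) :
  UltraFilter F -> UltraFilter (f @ F).
Proof.
move=> FU; split; first exact: fmap_proper_filter.
move=> G GF FG; rewrite predeqE => A; split; last exact: FG.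
move=> GA; have [//|FnA] := in_ultra_setVsetC (f @^-1` A) FU.
by have /(filterI GA) /filter_ex [? []] : G (~` A) by exact: FG.
Qed.

(** Compactness of a segment in ultrafilter form. It replaces the extraction of subsequences: one
    ultrafilter serves all times and coordinates at once. *)
Lemma ultra_bounded_cvg (R : realType) (T : Type) (F : set_system T)
    (f : T -> R) (a b : R) : UltraFilter F ->
  (forall k, a <= f k <= b) -> exists l : R, f @ F --> l.
Proof.
move=> FU fab; have := @segment_compact R a b; rewrite compact_ultra.
move=> /(_ (f @ F) (fmap_ultra _ _)) [].
  by apply: (@filterE _ F) => k; rewrite /= in_itv; exact: fab.
by move=> l [_ fl]; exists l.
Qed.

(** Caratheodory's criterion, with the difference quotient completed by [g] at [s]. Being free of
    division, the estimate passes easily to limits. *)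
Lemma is_derive1_dist (R : realType) (f : R -> R) (s g : R) :
  (forall e, 0 < e ->
     \forall t \near s, `|f t - f s - (t - s) * g| <= e * `|t - s|) ->
  is_derive s 1 f g.
Proof.
move=> fg; apply/is_derive1_caratheodory.
exists (fun z => if z == s then g else (f z - f s) / (z - s)).
split; last by rewrite eqxx.
- move=> z; case: eqVneq => [->|zs]; first by rewrite !subrr mulr0.
  by rewrite divfK ?subr_eq0.
- apply/cvgrPdist_le => e e0; have := fg e e0; rewrite eqxx.
  apply: filterS => z; case: eqVneq => [_ _|zs].
    by rewrite subrr normr0 ltW.
  have zs0 : z - s != 0 by rewrite subr_eq0.
  rewrite -ler_pdivrMr ?normr_gt0// -normf_div distrC.
  by congr (`|_| <= _); field.
Qed.

Lemma cvg_ptws (I : eqType) (T : topologicalType) (F : set_system (I -> T))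
    (f : I -> T) : Filter F ->
  (forall i, (fun g => g i) @ F --> f i) -> F --> (f : {ptws I -> T}).
Proof.
move=> FF Ff; apply/cvg_sup => i; apply/cvg_image.
  by rewrite eqEsubset; split=> v // _; exists (fun=> v).
apply: cvg_trans (Ff i) => W FW; exists ((fun g : I -> T => g i) @^-1` W) => //.
by rewrite eqEsubset; split=> [_ [g Wg <-]|v Wv] //; exists (fun=> v).
Qed.

(** The boxes around [x] form a filter base whose filter converges to [x] in each coordinate, hence
    pointwise; it therefore contains every neighbourhood of [x]. *)
Lemma nbhs_ptws_box (R : realType) (I : finType) (x : I -> R)
    (A : set (I -> R)) : nbhs (x : {ptws I -> R}) A ->
  exists2 d : R, 0 < d & forall y, (forall i, `|y i - x i| < d) -> A y.
Proof.
pose box (d : R) : set (I -> R) := [set y | forall i, `|y i - x i| < d].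
have FF : Filter (filter_from [set d : R | 0 < d] box).
  apply: filter_from_filter; first by exists 1; rewrite /= ltr01.
  move=> d e /= d0 e0; exists (Num.min d e); first by rewrite lt_min d0 e0.
  by move=> y ye; split=> i; move: (ye i); rewrite lt_min => /andP[].
suff /[apply] : filter_from [set d : R | 0 < d] box --> (x : {ptws I -> R}).
  by move=> [d /= d0 dA]; exists d => // y; exact: dA.
apply: cvg_ptws => i; apply/cvgrPdist_lt => e e0.
by exists e => // y /(_ i); rewrite distrC.
Qed.

(** * Euler schemes and their error estimates *)

Section Euler.
Context {R : realType} {I : Type}.
Variables (G : (I -> R) -> I -> R) (x0 : I -> R).

Definition euler (h : R) (n : nat) : I -> R :=
  iter n (fun x i => x i + h * G x i) x0.

(** Each step between the two nodes deviates from [h * g] by at most [h * e], and the deviations add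
    up. Both orders of [p] and [q] are needed for a two-sided derivative. *)
Lemma euler_drift (h : R) (p q : nat) (g : I -> R) (e : R) : 0 <= h ->
  (forall j, (minn p q <= j <= maxn p q)%N ->
     forall i, `|G (euler h j) i - g i| <= e) ->
  forall i, `|euler h q i - euler h p i - h * (q%:R - p%:R) * g i|
            <= h * `|q%:R - p%:R| * e.
Proof.
move=> h0; wlog pq : p q / (p <= q)%N.
  move=> wl; case/orP: (leq_total p q) => pq; first exact: wl.
  rewrite minnC maxnC => H i; have := wl _ _ pq H i.
  rewrite distrC (distrC p%:R); congr (`|_| <= _); ring.
rewrite (minn_idPl pq) (maxn_idPr pq); rewrite -(subnKC pq).
elim: (q - p)%N => [|m IHm] H i.
  by rewrite addn0 !subrr normr0 !(mulr0, mul0r) subrr normr0.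
have /IHm /(_ i) : forall j, (p <= j <= p + m)%N ->
    forall i, `|G (euler h j) i - g i| <= e.
  by move=> j /andP[pj jm]; apply: H; rewrite pj addnS ltnW.
have /(_ i) : forall i, `|G (euler h (p + m)) i - g i| <= e.
  by apply: H; rewrite leq_addr addnS /=.
rewrite addnS /= -/(euler h (p + m)).
have -> : (p + m).+1%:R - p%:R = m%:R + 1 :> R by rewrite -natr1 natrD; ring.
have -> : (p + m)%:R - p%:R = m%:R :> R by rewrite natrD; ring.
rewrite !(ger0_norm (ler0n _ _ : 0 <= m%:R :> R)).
rewrite (ger0_norm (_ : 0 <= m%:R + 1 :> R)) ?addr_ge0//.
move: (euler h _) (euler h p) => y x Hy Hx.
have -> : y i + h * G y i - x i - h * (m%:R + 1) * g i =
  (y i - x i - h * m%:R * g i) + h * (G y i - g i) by ring.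
apply: (le_trans (ler_normD _ _)).
have -> : h * (m%:R + 1) * e = h * m%:R * e + h * e by ring.
by rewrite lerD// normrM ger0_norm// ler_wpM2l.
Qed.

Lemma euler_lipschitz (h L : R) (p q : nat) : 0 <= h ->
  (forall x i, `|G x i| <= L) ->
  forall i, `|euler h q i - euler h p i| <= h * `|q%:R - p%:R| * L.
Proof.
move=> h0 GL i; have := @euler_drift h p q (fun=> 0) L h0.
by move/(_ _ i); rewrite mulr0 subr0; apply=> j _ k; rewrite subr0.
Qed.

(* Piecewise constant in [t]: only the limit has to be continuous, so the nodes
   need not be interpolated. *)
Definition euler_path (k : nat) (t : R) : I -> R :=
  euler k.+1%:R^-1 (Num.truncn (Num.max 0 t * k.+1%:R)).

(** Both times are rounded down, so the two rounding errors have the same sign and their difference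
    stays within one mesh. *)
Lemma trunc_step (k : nat) (s t : R) : 0 <= s -> 0 <= t ->
  `|k.+1%:R^-1 * ((Num.truncn (t * k.+1%:R))%:R - (Num.truncn (s * k.+1%:R))%:R)
    - (t - s)| <= k.+1%:R^-1 :> R.
Proof.
move=> s0 t0; set K : R := k.+1%:R; have K0 : 0 < K by rewrite ltr0n.
have /truncn_itv : 0 <= s * K by rewrite mulr_ge0// ltW.
have /truncn_itv : 0 <= t * K by rewrite mulr_ge0// ltW.
move: (Num.truncn _) (Num.truncn _) => p q; rewrite -!natr1.
move=> /andP[q1 q2] /andP[p1 p2].
have -> : K^-1 * (q%:R - p%:R) - (t - s) =
    K^-1 * ((q%:R - p%:R) - (t * K - s * K)).
  by field; rewrite gt_eqF.
rewrite normrM ger0_norm ?invr_ge0 ?(ltW K0)// -[leRHS]mulr1.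
rewrite ler_wpM2l ?invr_ge0 ?(ltW K0)// ler_norml; lra.
Qed.

Lemma max0_dist (s t : R) : `|Num.max 0 t - Num.max 0 s| <= `|t - s|.
Proof.
case: (leP 0 t) => t0; case: (leP 0 s) => s0; rewrite ler_norml;
  case: (ger0P (t - s)) => ts; lra.
Qed.

End Euler.

(** * Peano's existence theorem for bounded continuous fields *)

Section Peano.
Context {R : realType} {I : finType}.
Variables (G : (I -> R) -> I -> R) (x0 : I -> R) (L : R).
Hypothesis GL : forall x i, `|G x i| <= L.
Hypothesis Gcont : forall i,
  continuous (fun x : {ptws I -> R} => G x i : R).

Let w := euler_path G x0.

Lemma euler_path_lipschitz k s t i :
  `|w k t i - w k s i| <= (`|t - s| + k.+1%:R^-1) * L.
Proof.
have L0 : 0 <= L by exact: le_trans (GL x0 i).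
have h0 : 0 <= k.+1%:R^-1 :> R by rewrite invr_ge0.
apply: le_trans (@euler_lipschitz _ _ _ _ _ L _ _ h0 GL i) _.
rewrite ler_wpM2r// -[X in X * _]ger0_norm// -normrM.
have := @trunc_step R k (Num.max 0 s) (Num.max 0 t).
rewrite !le_max lexx => /(_ isT isT).
have := max0_dist s t; move: (Num.max 0 t - _) => D HD.
set x := k.+1%:R^-1 * _ => Hx.
rewrite -(subrK D x) (le_trans (ler_normD _ _))// addrC lerD//.
Qed.

(** Half of [d] covers the distance from the path at time [s] to [x], the other half the motion
    between the two times; so all intermediate nodes lie where [G] is within [e] of [G x], and
    [euler_drift] applies. The last term pays for rounding [t - s] to a multiple of the step. *)
Lemma euler_path_derivative (x : I -> R) (e d : R) k s t : 0 < s -> 0 < t ->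
  (forall y, (forall i, `|y i - x i| < d) ->
     forall i, `|G y i - G x i| <= e) ->
  (forall i, `|w k s i - x i| < d / 2) ->
  (`|t - s| + k.+1%:R^-1) * L < d / 2 ->
  forall i, `|w k t i - w k s i - (t - s) * G x i|
            <= (`|t - s| + k.+1%:R^-1) * e + k.+1%:R^-1 * L.
Proof.
move=> s0 t0 Gx wsx tsL i.
have L0 : 0 <= L by exact: le_trans (GL x0 i).
have h0 : 0 <= k.+1%:R^-1 :> R by rewrite invr_ge0.
have d0 : 0 < d / 2 by exact: le_lt_trans (wsx i).
have e0 : 0 <= e.
  by apply: le_trans (Gx x _ i) => // j; rewrite subrr normr0; lra.
have := @trunc_step R k s t (ltW s0) (ltW t0); move: wsx tsL.
rewrite /w /euler_path (max_r (ltW s0)) (max_r (ltW t0)).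
set h : R := k.+1%:R^-1 in h0 *; move: (Num.truncn _) (Num.truncn _) => q p.
move=> wsx tsL pq.
have hpq : h * `|q%:R - p%:R| <= `|t - s| + h.
  have -> : h * `|q%:R - p%:R| = `|h * (q%:R - p%:R) : R|.
    by rewrite normrM (ger0_norm h0).
  rewrite -[h * _](subrK (t - s)).
  apply: le_trans (ler_normD _ _) _; rewrite addrC lerD//.
have drift : forall j, (minn p q <= j <= maxn p q)%N ->
    forall i, `|G (euler G x0 h j) i - G x i| <= e.
  move=> j pjq; apply: Gx => l.
  rewrite -(subrK (euler G x0 h p l) (euler _ _ _ j l)) -addrA.
  apply: le_lt_trans (ler_normD _ _) _.
  rewrite [ltRHS]splitr ler_ltD//.
  apply: le_trans (@euler_lipschitz _ _ _ _ _ L _ _ h0 GL l) _.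
  apply: le_trans (ltW tsL); rewrite ler_wpM2r//.
  apply: le_trans hpq; rewrite ler_wpM2l//.
  move: pjq; case/orP: (leq_total p q) => pq'.
    rewrite (minn_idPl pq') (maxn_idPr pq') => /andP[pj jq].
    by rewrite !ger0_norm ?subr_ge0 ?ler_nat// lerD2r ler_nat.
  rewrite (minn_idPr pq') (maxn_idPl pq') => /andP[qj jp].
  by rewrite !ler0_norm ?subr_le0 ?ler_nat// !opprB lerD2l lerN2 ler_nat.
have := euler_drift h0 drift i.
set a := _ - _ - h * _ * _ => Ha.
rewrite (_ : _ - _ = a + (h * (q%:R - p%:R) - (t - s)) * G x i); last first.
  by rewrite /a; ring.
apply: le_trans (ler_normD _ _) _; rewrite lerD//.
  by apply: le_trans Ha _; rewrite ler_wpM2r.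
by rewrite normrM ler_pM.
Qed.

(** The estimates on Euler paths have errors that vanish with the mesh, so they survive the limit in
    [k]. The path is frozen for [t <= 0], which is why the equation is claimed at positive times
    only. *)
Lemma peano_bounded : exists u : R -> I -> R,
  [/\ forall t : R, t <= 0 -> u t = x0,
      forall (s t : R) i, `|u t i - u s i| <= `|t - s| * L
    & forall (t : R) i, 0 < t -> is_derive t 1 (fun s => u s i) (G (u t) i)].
Proof.
(* An ultrafilter finer than the eventual filter: ordinary limits, such as that of the mesh, persist
   along it. *)
have [U [UU oU]] := ultraFilterLemma (@eventually_filter).
have hU : (fun k => k.+1%:R^-1 : R) @ U --> (0 : R).
  exact: cvg_trans (cvg_app _ oU) (@cvg_harmonic R).
have w0 k t : t <= 0 -> w k t = x0.
  by move=> t0; rewrite /w /euler_path max_l// mul0r truncn0.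
have /choice [u0 wu0] : forall ti : R * I, exists l : R,
    (fun k => w k ti.1 ti.2) @ U --> l.
  move=> [t i]; have L0 : 0 <= L by exact: le_trans (GL x0 i).
  (* The Lipschitz estimate from time 0, with the mesh bounded by 1. *)
  apply: (@ultra_bounded_cvg _ _ _ _ (x0 i - (`|t| + 1) * L)
    (x0 i + (`|t| + 1) * L)) => k.
  have := @euler_path_lipschitz k 0 t i.
  rewrite (w0 k 0)// subr0 -ler_distlC distrC => /le_trans; apply.
  by rewrite ler_wpM2r// lerD2l invf_le1 ?ltr0n// ler1n.
pose u t i := u0 (t, i).
have wu t i : (fun k => w k t i) @ U --> u t i by exact: wu0 (t, i).
have stepU a b c : (fun k => (a + k.+1%:R^-1) * b + k.+1%:R^-1 * c : R) @ U -->
    (a * b : R).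
  have -> : a * b = (a + 0) * b + 0 * c by rewrite addr0 mul0r addr0.
  apply: cvgD; apply: cvgM; try exact: cvg_cst; last exact: hU.
  by apply: cvgD; [exact: cvg_cst|exact: hU].
exists u; split.
- move=> t t0; apply/funext => i.
  rewrite -(cvg_lim _ (wu t i))//.
  under eq_fun do rewrite w0//.
  exact: lim_cst.
- move=> s t i; apply: ler_cvg_to (stepU _ L 0) _.
    apply: cvg_norm; apply: cvgB; exact: wu.
  by apply: nearW => k; rewrite mulr0 addr0; exact: euler_path_lipschitz.
- move=> s i s0; apply: is_derive1_dist => e e0.
  have [|d d0 Gd] := @nbhs_ptws_box R I (u s)
      [set y | forall j, `|G y j - G (u s) j| <= e].
    apply: (@filter_forall _ I (fun j y => `|G y j - G (u s) j| <= e) _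
      (nbhs_filter (u s : {ptws I -> R}))) => j.
    have /cvgrPdist_le /(_ e e0) := @Gcont j (u s).
    by apply: filterS => y; rewrite distrC.
  have d20 : 0 < d / 2 by rewrite divr_gt0.
  have dist_near : `|t - s| * L @[t --> s] --> (0 : R).
    have -> : 0 = `|s - s| * L :> R by rewrite subrr normr0 mul0r.
    apply: cvgM; last exact: cvg_cst.
    by apply: cvg_norm; apply: cvgB => //; exact: cvg_cst.
  near=> t.
  have t0 : 0 < t by near: t; exact: lt_nbhsr.
  have tsL : `|t - s| * L < d / 2.
    by near: t; have /cvgr_lt := dist_near; apply.
  (* Here [t] is fixed and only [k] varies: the mesh terms disappear and leave [|t - s| * e]. *)
  rewrite [leRHS]mulrC; apply: ler_cvg_to (stepU _ e L) _.
    apply: cvg_norm; apply: cvgB; last exact: cvg_cst.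
    by apply: cvgB; exact: wu.
  have w_near : \forall k \near U, forall j, `|w k s j - u s j| < d / 2.
    apply: filter_forall => j; have /cvgrPdist_lt /(_ _ d20) := wu s j.
    by apply: filterS => k; rewrite distrC.
  have /cvgr_lt /(_ _ tsL) h_near := stepU `|t - s| L 0.
  apply: filterS2 w_near h_near => k wk; rewrite mulr0 addr0 => hk.
  exact: (euler_path_derivative s0 t0 Gd).
Unshelve. all: by end_near. Qed.

End Peano.

(** * Summation by parts and entropy dissipation *)

Section Dissipation.
Context {R : realType} {d N : nat}.
Implicit Types (u v f A B : torus d N -> R) (i : torus d N) (mu : 'I_d).

Lemma shift_plusK mu : cancel (@shift_plus d N mu) (shift_minus mu).
Proof.
move=> i; apply/ffunP => nu; rewrite !ffunE.
by case: eqP => // _; rewrite ordSK.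
Qed.

Lemma sum_diff_plus mu f : \sum_i diff_plus mu f i = 0.
Proof.
rewrite -mulr_sumr sumrB [X in _ - X](reindex_inj (can_inj (shift_plusK mu))).
by rewrite subrr mulr0.
Qed.

Lemma sum_divh_plus (F : torus d N -> 'rV[R]_d) : \sum_i divh_plus F i = 0.
Proof. by rewrite exchange_big big1 // => mu _; exact: sum_diff_plus. Qed.

(** The two summands together are the forward difference of [v (shift_minus mu j) * f j], whose sum
    over the torus vanishes. *)
Lemma sum_diff_by_parts mu v f :
  \sum_i v i * diff_plus mu f i = - \sum_i diff_minus mu v i * f i.
Proof.
apply/eqP; rewrite -addr_eq0 -big_split /=.
rewrite -[X in _ == X](sum_diff_plus mu (fun j => v (shift_minus mu j) * f j)).
apply/eqP/eq_bigr => i _; rewrite /diff_plus /diff_minus shift_plusK; ring.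
Qed.

(** After one summation by parts, [A] is paired with the backward gradient of [v] and [B] with [v]
    times it. A second one uses the exact product rule: the forward divergence of [v_i] times the
    backward gradient is [v_i * laph v i] plus the squared forward gradient. *)
Lemma sum_mul_divh_plus v A B :
  \sum_i v i * divh_plus (fun j => gradh_minus A j - v j *: gradh_minus B j) i =
  \sum_i (A i * laph v i - B i * (v i * laph v i + sqnorm (gradh_plus v i))).
Proof.
rewrite sumrB.
have -> : \sum_i A i * laph v i =
    - \sum_mu \sum_i diff_minus mu A i * diff_minus mu v i.
  under eq_bigr do rewrite mulr_sumr.
  rewrite exchange_big -sumrN; apply: eq_bigr => mu _.
  rewrite sum_diff_by_parts; congr (- _); apply: eq_bigr => i _.
  by rewrite mxE.
have -> : \sum_i B i * (v i * laph v i + sqnorm (gradh_plus v i)) =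
    - \sum_mu \sum_i diff_minus mu B i * (v i * diff_minus mu v i).
  under eq_bigr do rewrite mulr_sumr -big_split mulr_sumr.
  rewrite exchange_big -sumrN; apply: eq_bigr => mu _.
  rewrite -sum_diff_by_parts; apply: eq_bigr => i _; congr (_ * _).
  rewrite /diff_plus !mxE /diff_minus /diff_plus shift_plusK /=; ring.
under eq_bigr do rewrite mulr_sumr.
rewrite exchange_big opprK -sumrN -big_split; apply: eq_bigr => mu _ /=.
rewrite sum_diff_by_parts -sumrN -sumrN -big_split; apply: eq_bigr => i _ /=.
rewrite !mxE; ring.
Qed.

(** For a general exponent the summand is [avg ^ beta * (xi2 - 2 * xi1sq) * (xi2 - beta * xi1sq)];
    it becomes a square at [beta = 2]. *)
Lemma dissipation_ge0 (avg : torus d N -> (torus d N -> R) -> R) u :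
  positive_grid u ->
  0 <= \sum_i vvar u i * divh_plus (flux 2 avg u) i.
Proof.
move=> u0; rewrite sum_mul_divh_plus.
apply: sumr_ge0 => i _; rewrite /Afun /Bfun /lambda1 /lambda2 /lambda3 /lambda4.
have v0 : vvar u i != 0 by rewrite oppr_eq0 invr_eq0 gt_eqF.
have -> : laph (vvar u) i = vvar u i * xi2 (vvar u) i.
  by rewrite /xi2; field.
have -> : sqnorm (gradh_plus (vvar u) i) = vvar u i ^+ 2 * xi1sq (vvar u) i.
  rewrite /xi1sq /sqnorm mulr_sumr; apply: eq_bigr => mu _.
  by rewrite !mxE; field.
rewrite [X in 0 <= X](_ : _ = avg i u `^ 2 *
    (xi2 (vvar u) i - 2 * xi1sq (vvar u) i) ^+ 2); last by field.
by rewrite mulr_ge0 ?powR_ge0 ?sqr_ge0.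
Qed.

End Dissipation.

(** * Clamping and the extended entropy *)

Section Clamp.
Context {R : realType}.
Variables (a b : R).
Hypothesis ab : a <= b.

Definition clamp (s : R) : R := Num.max a (Num.min b s).

Lemma clamp_itv s : a <= clamp s <= b.
Proof. by rewrite /clamp le_max lexx ge_max ab ge_min lexx. Qed.

Lemma clamp_id s : a <= s <= b -> clamp s = s.
Proof. by move=> /andP[sa sb]; rewrite /clamp (min_r sb) (max_r sa). Qed.

Lemma clamp_le s : s <= a -> clamp s = a.
Proof.
by move=> sa; rewrite /clamp (min_r (le_trans sa ab)) (max_l sa).
Qed.

Lemma clamp_dist s t : `|clamp t - clamp s| <= `|t - s|.
Proof.
rewrite /clamp; case: (leP b s) => bs; case: (leP b t) => bt;
  rewrite ?(max_r ab) ?subrr ?normr0//; try case: (leP a t) => ta;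
  try case: (leP a s) => sa; case: (ger0P (t - s)) => ts;
  rewrite ?ler_norml; have := ab; lra.
Qed.

(* The primitive of [- 1 / clamp] which is [- ln] on [[a, b]], extended by its
   tangents.  It is the maximum over [c] in [[a, b]] of [1 - ln c - s / c]. *)
Definition clamped_entropy (s : R) : R := 1 - ln (clamp s) - s / clamp s.

Hypothesis a0 : 0 < a.

Lemma clamp_gt0 s : 0 < clamp s.
Proof. by have /andP[+ _] := clamp_itv s; exact: lt_le_trans. Qed.

Lemma clamped_entropy_id s : a <= s <= b -> clamped_entropy s = - ln s.
Proof.
move=> sab; rewrite /clamped_entropy clamp_id// divff; first by ring.
by rewrite gt_eqF// (lt_le_trans a0)//; case/andP: sab.
Qed.

(** Two convexity facts are added: the tangent bound for [ln] at [c], and the obtuse angle property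
    of the projection [clamp s] onto the segment. *)
Lemma clamped_entropy_ge c s : a <= c <= b ->
  1 - ln c - s / c <= clamped_entropy s.
Proof.
move=> /andP[ac cb]; have c0 : 0 < c by exact: lt_le_trans ac.
have m0 := clamp_gt0 s; rewrite /clamped_entropy.
have lnm : ln (clamp s) - ln c <= clamp s / c - 1.
  rewrite -ln_div ?posrE// -{1}(subrKC 1 (clamp s / c)).
  by apply: le_ln1Dx; rewrite ltrBrDl subrr divr_gt0.
have proj : (clamp s - c) * (clamp s - s) <= 0.
  rewrite /clamp; case: (leP b s) => bs.
    by rewrite (max_r ab) mulr_ge0_le0 ?subr_ge0 ?subr_le0.
  case: (leP a s) => sa; first by rewrite subrr mulr0.
  by rewrite mulr_le0_ge0 ?subr_ge0 ?subr_le0// ltW.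
have : (clamp s - c) * (clamp s - s) / (c * clamp s) <= 0.
  by rewrite mulr_le0_ge0// invr_ge0 mulr_ge0// ltW.
have -> : (clamp s - c) * (clamp s - s) / (c * clamp s) =
    clamp s / c - 1 - s / c + s / clamp s.
  by field; rewrite !gt_eqF.
lra.
Qed.

(** An envelope argument: maximality at [t] and at [s] squeezes the increment between
    [- (t - s) / clamp s] and [- (t - s) / clamp t], with no case distinction at [a] and [b]. *)
Lemma is_derive_clamped_entropy (s : R) :
  is_derive s 1 clamped_entropy (- (clamp s)^-1).
Proof.
apply: is_derive1_dist => e e0.
(* The factor [a ^+ 2] compensates the Lipschitz constant [a ^- 2] of inversion above [a]. *)
have near_s : \forall t \near s, `|t - s| <= e * a ^+ 2.
  have e2 : 0 < e * a ^+ 2 by rewrite mulr_gt0// exprn_gt0.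
  have /cvgrPdist_le /(_ _ e2) : t @[t --> s] --> s by exact: cvg_id.
  by apply: filterS => t; rewrite distrC.
apply: filterS near_s => t ts.
have ge_t := clamped_entropy_ge t (clamp_itv s).
have ge_s := clamped_entropy_ge s (clamp_itv t).
have slope : (t - s) * ((clamp s)^-1 - (clamp t)^-1) <= e * `|t - s|.
  rewrite (le_trans (ler_norm _))// normrM mulrC ler_wpM2r//.
  have -> : (clamp s)^-1 - (clamp t)^-1 =
      (clamp t - clamp s) / (clamp s * clamp t).
    by field; rewrite !gt_eqF ?clamp_gt0.
  rewrite normrM normfV ler_pdivrMr ?normr_gt0; last first.
    by rewrite mulf_neq0// gt_eqF ?clamp_gt0.
  rewrite (le_trans (clamp_dist _ _))// (le_trans ts)// ler_wpM2l ?(ltW e0)//.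
  rewrite (le_trans _ (ler_norm _))// expr2.
  have /andP[sa _] := clamp_itv s; have /andP[ta _] := clamp_itv t.
  by rewrite ler_pM// (ltW a0).
rewrite ger0_norm; move: ge_t ge_s slope; rewrite /clamped_entropy; nra.
Qed.

(* [clamped_entropy s + s / b] is bounded below, so that conservation of mass
   prevents one coordinate from compensating the entropy of another. *)
Lemma clamped_entropy_confinement (I : finType) (x : I -> R) (S : R) :
  \sum_i x i <= b -> \sum_i clamped_entropy (x i) <= S ->
  S + 1 + #|I|%:R * `|ln b| < - ln a -> forall i, a < x i.
Proof.
move=> xb xS Sa i; rewrite ltNge; apply/negP => xia.
have b0 : 0 < b by exact: lt_le_trans ab.
pose psi s := clamped_entropy s + s / b + `|ln b|.
have psi0 s : 0 <= psi s.
  have := @clamped_entropy_ge b s; rewrite ab lexx => /(_ isT).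
  have := ler_norm (ln b); rewrite /psi; lra.
(* Below [a] the slope of [psi] is [1 / b - 1 / a <= 0], so [psi] is at least its value at [a]. *)
have psi_a : - ln a <= psi (x i).
  rewrite /psi /clamped_entropy clamp_le//.
  have : (a - x i) * b^-1 <= (a - x i) * a^-1.
    by rewrite ler_wpM2l ?subr_ge0// lef_pV2.
  have : 0 <= a / b by rewrite divr_ge0 ?ltW.
  have := normr_ge0 (ln b); rewrite !mulrBl divff ?gt_eqF//; move=> *; lra.
have : psi (x i) <= \sum_j psi (x j).
  by rewrite (bigD1 i)//= lerDl sumr_ge0.
have -> : \sum_j psi (x j) = \sum_j clamped_entropy (x j) +
    (\sum_j x j) / b + #|I|%:R * `|ln b|.
  by rewrite /psi 2!big_split /= sumr_const mulr_suml mulr_natl.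
(* This bound on the mass term accounts for the summand 1 in the threshold. *)
have : (\sum_j x j) / b <= 1 by rewrite ler_pdivrMr// mul1r.
by move=> *; lra.
Qed.

End Clamp.

(** * Finite sums, monotonicity and Lipschitz continuity *)

Lemma cvg_fsum (R : realType) (T : Type) (I : finType) (F : set_system T)
    (f : I -> T -> R) (l : I -> R) : Filter F ->
  (forall i, f i @ F --> l i) -> (fun k => \sum_i f i k) @ F --> \sum_i l i.
Proof. by move=> FF fl; apply: cvg_big => //; exact: add_continuous. Qed.

Lemma is_derive_fsum (R : realType) (I : finType) (f : I -> R -> R)
    (df : I -> R) (t : R) : (forall i, is_derive t 1 (f i) (df i)) ->
  is_derive t 1 (fun s => \sum_i f i s) (\sum_i df i).
Proof.
move=> fdf; elim: (index_enum I) => [|i r IHr].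
  rewrite big_nil; under eq_fun do rewrite big_nil; exact: is_derive_cst.
rewrite big_cons; under eq_fun do rewrite big_cons; exact: is_deriveD.
Qed.

Lemma is_derive_le0_le (R : realType) (f df : R -> R) (t : R) : 0 <= t ->
  continuous f -> (forall s : R, 0 < s -> is_derive s 1 f (df s)) ->
  (forall s, 0 < s -> df s <= 0) -> f t <= f 0.
Proof.
move=> t0 fc fdf df0; apply: (@ler0_derive1_nincry R f 0) => //.
- by move=> s; rewrite in_itv /= andbT => /fdf [].
- move=> s; rewrite in_itv /= andbT => s0.
  by rewrite derive1E; have [_ ->] := fdf s s0; exact: df0.
- exact: continuous_subspaceT.
Qed.

Lemma lipschitz_continuous (R : realType) (f : R -> R) (L : R) :
  (forall s t, `|f t - f s| <= `|t - s| * L) -> continuous f.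
Proof.
move=> fL s; apply/cvgrPdist_le => e e0.
have L1 : 0 < `|L| + 1 by rewrite ltr_wpDl.
have eL : 0 < e / (`|L| + 1) by rewrite divr_gt0.
have /cvgrPdist_le /(_ _ eL) : t @[t --> s] --> s by exact: cvg_id.
apply: filterS => t; rewrite ler_pdivlMr// => /(le_trans _); apply.
rewrite (le_trans (fL t s))// ler_wpM2l//.
by rewrite (le_trans (ler_norm _))// lerDl.
Qed.

(** * Continuity of the discrete operators and of the flux *)

Section SchemeContinuity.
Context {R : realType} {d N : nat}.
Context {T : Type} {F : set_system T} {FF : Filter F}.
Implicit Types (f : T -> torus d N -> R) (l : torus d N -> R).

Lemma cvg_diff_plus mu f l i : (forall j, f ^~ j @ F --> l j) ->
  (fun k => diff_plus mu (f k) i) @ F --> diff_plus mu l i.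
Proof. by move=> fl; apply: cvgM; [exact: cvg_cst|exact: cvgB]. Qed.

Lemma cvg_diff_minus mu f l i : (forall j, f ^~ j @ F --> l j) ->
  (fun k => diff_minus mu (f k) i) @ F --> diff_minus mu l i.
Proof. by move=> fl; apply: cvgM; [exact: cvg_cst|exact: cvgB]. Qed.

Lemma cvg_divh_plus (f : T -> torus d N -> 'rV[R]_d)
    (l : torus d N -> 'rV[R]_d) i :
  (forall j mu, (fun k => f k j 0 mu) @ F --> l j 0 mu) ->
  (fun k => divh_plus (f k) i) @ F --> divh_plus l i.
Proof.
by move=> fl; apply: cvg_fsum => mu; apply: cvg_diff_plus => j; exact: fl.
Qed.

Lemma cvg_laph f l i : (forall j, f ^~ j @ F --> l j) ->
  (fun k => laph (f k) i) @ F --> laph l i.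
Proof.
move=> fl; apply: cvg_divh_plus => j mu; rewrite mxE.
by under eq_fun do rewrite mxE; exact: cvg_diff_minus.
Qed.

Lemma cvg_flux (avg : torus d N -> (torus d N -> R) -> R) f l i mu :
  (forall k, positive_grid (f k)) -> positive_grid l ->
  (forall k j, 0 <= avg j (f k)) -> (forall j, 0 <= avg j l) ->
  (forall j, f ^~ j @ F --> l j) ->
  (forall j, (fun k => avg j (f k)) @ F --> avg j l) ->
  (fun k => flux 2 avg (f k) i 0 mu) @ F --> flux 2 avg l i 0 mu.
Proof.
move=> f0 l0 af0 al0 fl avgl.
have vl j : (fun k => vvar (f k) j) @ F --> vvar l j.
  by apply: cvgN; apply: cvgV => //; rewrite gt_eqF.
have v0 j : vvar l j != 0 by rewrite oppr_eq0 invr_eq0 gt_eqF.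
have avg2 j : (fun k => avg j (f k) `^ 2) @ F --> avg j l `^ 2.
  (* Nonnegativity of the averages turns the real power into an ordinary square. *)
  under eq_fun do rewrite powR_mulrn//.
  by rewrite powR_mulrn//; apply: cvgM.
have xi2l j : (fun k => xi2 (vvar (f k)) j) @ F --> xi2 (vvar l) j.
  by apply: cvgM; [exact: cvg_laph|exact: cvgV].
have xi1l j : (fun k => xi1sq (vvar (f k)) j) @ F --> xi1sq (vvar l) j.
  apply: cvg_fsum => nu; rewrite !mxE; under eq_fun do rewrite !mxE.
  by apply: cvgM; apply: cvgM; (exact: cvgV || exact: cvg_diff_plus).
have cl (c e : R) j :
    (fun k => c * xi2 (vvar (f k)) j + e * xi1sq (vvar (f k)) j) @ F
    --> c * xi2 (vvar l) j + e * xi1sq (vvar l) j.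
  by apply: cvgD; apply: cvgM => //; exact: cvg_cst.
rewrite !mxE; under eq_fun do rewrite !mxE.
apply: cvgB; first apply: cvg_diff_minus => j.
  by apply: cvgM => //; apply: cvgM => //; exact: cvgV.
apply: cvgM => //; apply: cvg_diff_minus => j.
apply: cvgM => //; apply: cvgM => //; apply: cvgV; first by rewrite expf_neq0.
exact: cvgM.
Qed.

End SchemeContinuity.

(** * Compactness of boxes and choice of the lower barrier *)

Lemma ptws_box_bounded (R : realType) (I : finType) (G : (I -> R) -> I -> R)
    (a b : R) : (forall i, continuous (fun x : {ptws I -> R} => G x i : R)) ->
  exists L : R, forall x : I -> R, (forall i, a <= x i <= b) ->
    forall i, `|G x i| <= L.
Proof.
move=> Gc.
pose K : set {ptws I -> R} := [set x | forall i, `[a, b]%classic (x i)].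
have GK i : \forall L \near +oo, forall y, [set (G x i : R) | x in K] y ->
    `|y| <= L.
  apply: compact_bounded; apply: continuous_compact.
    by apply: continuous_subspaceT; exact: Gc.
  apply: (@tychonoff I (fun=> R) (fun=> `[a, b]%classic)) => j.
  exact: segment_compact.
have [L GL] := filter_ex (filter_forall _ GK).
by exists L => x xab i; apply: GL; exists x.
Qed.

Lemma exists_small_pos (R : realType) (I : finType) (x : I -> R) (b K : R) :
  0 < b -> (forall i, 0 < x i) ->
  exists a : R, [/\ 0 < a, a <= b, forall i, a <= x i & K < - ln a].
Proof.
move=> b0 x0; suff : \forall a \near (0 : R)^'+,
    [/\ 0 < a, a < b, forall i, a < x i & a < expR (- K)].
  move=> /filter_ex [a [a0 ab ax aK]].
  exists a; split => //; [exact: ltW|by move=> i; exact/ltW|].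
  by rewrite ltrNr -[ltRHS]expRK ltr_ln ?posrE ?expR_gt0.
near=> a; split; near: a.
- exact: nbhs_right_gt.
- exact: nbhs_right_lt.
- by apply: filter_forall => i; exact: nbhs_right_lt.
- exact/nbhs_right_lt/expR_gt0.
Unshelve. all: by end_near. Qed.

(** * Construction of the global positive solution *)

Theorem lemma12 (R : realType) (d N : nat) (hd : (0 < d)%N) (hN : (0 < N)%N)
    (beta : R) (hbeta : beta = 2)
    (V : torus d N -> {set torus d N})
    (avg : torus d N -> (torus d N -> R) -> R) (havg : is_average V avg)
    (u0 : torus d N -> R) (hu0 : positive_grid u0) :
  exists u : R -> torus d N -> R,
    [/\ forall i, u 0 i = u0 i,
        forall t : R, 0 <= t -> positive_grid (u t),
        forall i, {within `[0, +oo[, continuous (fun t : R => u t i)},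
        forall (t : R) i, 0 < t ->
          is_derive t 1 (fun s : R => u s i) (- divh_plus (flux beta avg (u t)) i)
      & forall t : R, 0 < t ->
          derivable (fun s : R => entropy0 (u s)) t 1 /\
          derive1 (fun s : R => entropy0 (u s)) t <= 0].
Proof.
subst beta.
pose I := torus d N.
pose S : R := \sum_i - ln (u0 i).
(* Positive coordinates of conserved mass stay below this number. *)
pose b : R := \sum_i u0 i + 1.
have sum_u0 : 0 <= \sum_i u0 i by apply: sumr_ge0 => i _; exact/ltW.
have b0 : 0 < b by rewrite ltr_wpDl.
(* The threshold of [clamped_entropy_confinement]; it depends on the initial data only, so [a] is
   fixed before the field is defined. *)
pose K := S + 1 + #|I|%:R * `|ln b|.
have [a [a0 ab au0 aK]] := exists_small_pos K b0 hu0.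
have u0ab i : a <= u0 i <= b.
  rewrite au0 /b (bigD1 i)//= -addrA lerDl addr_ge0//.
  by apply: sumr_ge0 => j _; exact/ltW.
pose G (x : I -> R) i := - divh_plus (flux 2 avg (fun j => clamp a b (x j))) i.
have clampP (x : I -> R) : positive_grid (fun j => clamp a b (x j)).
  by move=> j; exact: clamp_gt0.
have avg_ge0 i x : positive_grid x -> 0 <= avg i x.
  move=> x0; have : forall j, j \in V i -> 0 <= x j <= \sum_k x k.
    move=> j _; rewrite ltW//= (bigD1 j)//= lerDl.
    by apply: sumr_ge0 => k _; exact/ltW.
  by move/(average_between havg x0)/andP => [].
have Gcont i : continuous (fun x : {ptws I -> R} => G x i : R).
  move=> x; pose F := nbhs (x : {ptws I -> R}).
  have FF : Filter F by exact: nbhs_filter.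
  suff : (fun y => G y i) @ F --> G x i by [].
  have xl j : (fun y => y j) @ F --> x j.
    exact: (@proj_continuous I (fun=> R) j x).
  have cl j : (fun y => clamp a b (y j)) @ F --> clamp a b (x j).
    apply/cvgrPdist_le => e e0; have /cvgrPdist_le /(_ e e0) := xl j.
    by apply: filterS => y; exact/le_trans/clamp_dist.
  apply: cvgN; apply: cvg_divh_plus => j mu; apply: cvg_flux => //.
  - by move=> k ?; exact: avg_ge0.
  - by move=> ?; exact: avg_ge0.
  - move=> k.
    apply: (@cvg_comp _ _ _ (fun y j => clamp a b (y j)) (avg k) _
      (nbhs ((fun j => clamp a b (x j)) : {ptws I -> R}))).
      exact: cvg_ptws.
    exact: (average_continuous havg (clampP x)).
have [L GL] : exists L : R, forall x i, `|G x i| <= L.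
  have [L GL] := ptws_box_bounded a b Gcont.
  (* Clamping is idempotent, so a bound on the box bounds [G] everywhere. *)
  exists L => x i; have := GL (fun j => clamp a b (x j)) _ i.
  rewrite /G.
  under [X in divh_plus (flux _ _ X)]eq_fun do rewrite clamp_id ?clamp_itv//.
  by apply=> j; exact: clamp_itv.
have [u [u_init u_lip u_der]] := peano_bounded u0 GL Gcont.
have u_cont i : continuous (fun t : R => u t i).
  by apply: (@lipschitz_continuous _ _ L) => s t; exact: u_lip.
have phi_cont : continuous (clamped_entropy a b).
  move=> s; apply/differentiable_continuous/derivable1_diffP.
  by have [] := is_derive_clamped_entropy ab a0 s.
have sum_cont (f : R -> R) : continuous f ->
    continuous (fun t => \sum_i f (u t i)).
  move=> fc t; apply: cvg_fsum => i.
  exact: (cvg_comp _ _ (u_cont i t) (fc (u t i))).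
have mass t : \sum_i u t i = \sum_i u0 i.
  case: (leP t 0) => [/u_init ->//|/ltW t0]; rewrite -(u_init 0)//.
  have sum_der (s : R) : 0 < s -> is_derive s 1 (fun t => \sum_i u t i) 0.
    move=> s0; have := is_derive_fsum (fun i => u_der s i s0).
    by rewrite sumrN sum_divh_plus oppr0.
  have sum_u_cont := sum_cont id (fun x => cvg_id).
  apply/eqP; rewrite eq_le; apply/andP; split.
    exact: (is_derive_le0_le t0 sum_u_cont sum_der).
  rewrite -lerN2.
  apply: (@is_derive_le0_le _ (fun s => - \sum_i u s i) (fun=> - 0) t t0).
  - by move=> s; apply: cvgN; exact: sum_u_cont.
  - by move=> s /sum_der ?; exact: is_deriveN.
  - by rewrite oppr0.
pose Phi t := \sum_i clamped_entropy a b (u t i).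
have Phi_der (t : R) : 0 < t -> is_derive t 1 Phi
    (\sum_i - (clamp a b (u t i))^-1 * G (u t) i).
  move=> t0; apply: is_derive_fsum => i.
  apply: is_derive1_comp; first exact: is_derive_clamped_entropy.
  exact: u_der.
(* The derivative [- 1 / clamp] is [vvar] of the clamped state, where [G] is also evaluated; the
   dissipation inequality thus applies before [u t] is known to lie in the box. *)
have Phi_der_le0 t : \sum_i - (clamp a b (u t i))^-1 * G (u t) i <= 0.
  rewrite -oppr_ge0 -sumrN.
  under eq_bigr do rewrite -mulrN opprK.
  exact: (dissipation_ge0 avg (clampP (u t))).
have Phi_le t : Phi t <= S.
  have Phi0 : \sum_i clamped_entropy a b (u0 i) = S.
    by apply: eq_bigr => i _; rewrite clamped_entropy_id.
  case: (leP t 0) => [/u_init ut|/ltW t0]; first by rewrite /Phi ut Phi0.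
  rewrite -Phi0 -(u_init 0)//.
  exact: (is_derive_le0_le t0 (sum_cont _ phi_cont) Phi_der).
(* Mass and entropy bounds hold for the clamped flow at all times, so confinement follows without a
   first exit time. *)
have u_gt t : forall i, a < u t i.
  apply: (clamped_entropy_confinement ab a0 _ (Phi_le t) aK).
  by rewrite mass lerDl.
have u_gt0 t i : 0 < u t i by exact: lt_trans (u_gt t i).
have u_box t i : a <= u t i <= b.
  rewrite ltW//=; apply: (@le_trans _ _ (\sum_j u t j)).
    by rewrite (bigD1 i)//= lerDl sumr_ge0// => j _; exact/ltW.
  by rewrite mass lerDl.
have u_clamp t : (fun i => clamp a b (u t i)) = u t.
  by apply/funext => i; rewrite clamp_id.
exists u; split.
- by move=> i; rewrite u_init.
- by move=> t _; exact: u_gt0.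
- by move=> i; exact: continuous_subspaceT.
- by move=> t i t0; have := u_der t i t0; rewrite /G u_clamp.
- move=> t t0.
  (* Since [u s] lies in the box for every real [s], the entropy and its extension agree as
     functions of time. *)
  have -> : (fun s => entropy0 (u s)) = @mesh_size R N \*: Phi.
    apply/funext => s; congr (_ * _); apply: eq_bigr => i _.
    by rewrite clamped_entropy_id.
  have [entropy_derivable entropy_val] :=
    is_deriveZ (@mesh_size R N) (Phi_der t t0).
  split=> //; rewrite derive1E entropy_val.
  by rewrite mulr_ge0_le0// invr_ge0.
Qed.
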